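(* Let $C_\#$ be the bivariate copula with density \[ c_\#(u,v)=2\big(\mathbf{1}_{[0,\frac12)}(u)\mathbf{1}_{[\frac12,1]}(v)+\mathbf{1}_{[\frac12,1]}(u)\mathbf{1}_{[0,\frac12)}(v)\big). \] Then $\psi(C_\#)=-\frac12$ and $\xi(C_\#)=\frac12$. Moreover, for every bivariate copula $C$ with $\psi(C)=-\frac12$ one has $\xi(C)\ge\frac12$, with equality if and only if $C=C_\#$.
   Context: For a bivariate copula $C$: $\xi(C)=6\int_0^1\int_0^1(\partial_1C(u,v))^2\,du\,dv-2$ and $\psi(C)=6\int_0^1C(u,u)\,du-2$; $-\frac12$ is the smallest possible value of $\psi$ over all copulas. *)

(* Defs.v *)
From HB Require Import structures.
From mathcomp Require Import all_boot all_order all_algebra.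
From mathcomp Require Import all_classical all_reals all_analysis.
Set Implicit Arguments. Unset Strict Implicit. Unset Printing Implicit Defensive.
Import Order.TTheory GRing.Theory Num.Theory.
Import numFieldNormedType.Exports.
Local Open Scope classical_set_scope.
Local Open Scope ring_scope.

Section Copulas.
Variable R : realType.

Definition leb01 (x : R) : Prop := 0 <= x <= 1.

(* A bivariate copula, given by its values on [0,1]^2 (values outside
   [0,1]^2 are irrelevant): grounded, uniform margins, 2-increasing. *)
Definition is_copula (C : R -> R -> R) : Prop :=
  (forall u, leb01 u ->
     C u 0 = 0 /\ C 0 u = 0 /\ C u 1 = u /\ C 1 u = u) /\
  (forall u1 u2 v1 v2, leb01 u1 -> leb01 u2 -> leb01 v1 -> leb01 v2 ->
     u1 <= u2 -> v1 <= v2 ->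
     0 <= C u2 v2 - C u2 v1 - C u1 v2 + C u1 v1).

Definition lebR := (@lebesgue_measure R).

Definition Int (a b : R) (f : R -> R) : R :=
  Rintegral lebR `[a, b] f.

Definition d1 (C : R -> R -> R) (u v : R) : R :=
  derive1 (fun x => C x v) u.

Definition xi (C : R -> R -> R) : R :=
  6 * Int 0 1 (fun v => Int 0 1 (fun u => (d1 C u v) ^+ 2)) - 2.

Definition psi (C : R -> R -> R) : R :=
  6 * Int 0 1 (fun u => C u u) - 2.

Definition csharp (s t : R) : R :=
  2 * ((\1_(`[0, 2^-1[) s) * (\1_(`[2^-1, 1]) t)
     + (\1_(`[2^-1, 1]) s) * (\1_(`[0, 2^-1[) t)).

Definition Csharp (u v : R) : R :=
  Int 0 u (fun s => Int 0 v (fun t => csharp s t)).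

End Copulas.

(* Main.v *)
(* Write lo u and hi u for the lengths of [0,u] inside the two halves of [0,1].
   Then C_#(u,v) = 2 (lo u hi v + hi u lo v), and a copula C satisfies
   psi C = -1/2 iff its diagonal is the least possible one, which forces
   C(1/2,1/2) = 0 and hence C(1/2,v) = hi v. For fixed v the map u |-> C(u,v) is
   1-Lipschitz, so it is the integral of its a.e. derivative g. Integrating
   g^2 >= 2wg - w^2, with w the step function d1 C_#(.,v) corrected by a constant
   on an interval ending at u, gives for every u
     int_0^1 (d1 C(x,v))^2 dx >= 2 lo(v)^2 + 2 hi(v)^2 + (C(u,v) - C_#(u,v))^2.
   The right-hand side is continuous in v; its first two terms integrate to 5/12,
   which is the bound xi >= 1/2, and the last one forces C = C_# in case of
   equality. *)
Require Import Defs.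
From HB Require Import structures.
From mathcomp Require Import all_boot all_order all_algebra.
From mathcomp Require Import all_classical all_reals all_analysis.
From mathcomp Require Import measurable_realfun ring lra.
Import Order.TTheory GRing.Theory Num.Theory.
Import numFieldNormedType.Exports.
Local Open Scope classical_set_scope.
Local Open Scope ring_scope.

(** * Integrals of nonnegative functions that may fail to be measurable *)

Section Integral.
Context d (T : measurableType d) (R : realType).
Variable mu : {measure set T -> \bar R}.
Local Open Scope ereal_scope.

(* The integral of a nonnegative function is a supremum over the simple functions
   below it. Working with monotonicity alone avoids proving the measurability of
   d1 C, whose values are junk where C is not differentiable, and of the inner
   integral of xi. *)
Lemma ge0_le_integral_nonmeasurable (D : set T) (f g : T -> \bar R) :
  (forall x, D x -> 0 <= f x) -> (forall x, D x -> f x <= g x) ->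
  \int[mu]_(x in D) f x <= \int[mu]_(x in D) g x.
Proof.
move=> f0 fg; rewrite !ge0_integralE//; last first.
  by move=> x Dx; exact: le_trans (f0 _ Dx) (fg _ Dx).
apply: ereal_sup_le => _ [h hf <-]; exists h => // x.
by apply: (le_trans (hf x)); apply: lee_restrict.
Qed.

(** [f] is squeezed between two modifications of [g], equal to 0 and to [+oo] on [N]. Both are
    measurable and have the integral of [g], so monotonicity suffices. *)
Lemma ge0_eq_integral_off_null (D N : set T) (f g : T -> \bar R) :
  measurable D -> measurable N -> mu N = 0 -> measurable_fun D g ->
  (forall x, D x -> 0 <= f x) -> (forall x, D x -> 0 <= g x) ->
  (forall x, D x -> ~ N x -> f x = g x) ->
  \int[mu]_(x in D) f x = \int[mu]_(x in D) g x.
Proof.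
move=> mD mN N0 mg f0 g0 fg.
pose h (c : \bar R) x := if x \in N then c else g x.
have hE c : 0 <= c -> \int[mu]_(x in D) h c x = \int[mu]_(x in D) g x.
  move=> c0; apply: ge0_ae_eq_integral => //.
  - apply: measurable_fun_if => //; last exact: measurable_funS mg.
    apply: (@measurable_fun_bool _ _ _ _ true); apply: measurableI => //.
    rewrite [X in measurable X](_ : _ = N)//.
    by apply/seteqP; split=> x /=; [exact: set_mem|exact: mem_set].
  - by move=> x Dx; rewrite /h; case: ifP => // _; exact: g0.
  - exists N; split => // x /= /not_implyP[Dx].
    by rewrite /h; case: ifPn => [/set_mem//|_ /(_ erefl)].
apply/eqP; rewrite eq_le; apply/andP; split.
- rewrite -(hE +oo)//; apply: ge0_le_integral_nonmeasurable => // x Dx.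
  rewrite /h; case: ifPn => [_|/negP xN]; first exact: leey.
  by rewrite fg// => Nx; apply: xN; rewrite inE.
- rewrite -(hE 0)//; apply: ge0_le_integral_nonmeasurable => x Dx.
    by rewrite /h; case: ifP => // _; exact: g0.
  rewrite /h; case: ifPn => [_|/negP xN]; first exact: f0.
  by rewrite fg// => Nx; apply: xN; rewrite inE.
Qed.

End Integral.

(** * Integrals of real functions over compact intervals *)

Section Int.
Context {R : realType}.
Notation mu := (@lebesgue_measure R).
Implicit Types (a b c M : R) (f g h : R -> R).

Lemma IntE a b f : Int a b f = \int[mu]_(x in `[a, b]) f x.
Proof. by []. Qed.

Lemma continuous_integrable_itv a b f : continuous f ->
  mu.-integrable `[a, b] (EFin \o f).
Proof.
move=> cf; apply: continuous_compact_integrable; first exact: segment_compact.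
exact: continuous_subspaceT.
Qed.

Lemma bounded_integrable_itv a b M f : measurable_fun setT f ->
  (forall x, `|f x| <= M) -> mu.-integrable `[a, b] (EFin \o f).
Proof.
move=> mf fM; apply: measurable_bounded_integrable.
- exact: measurable_itv.
- by rewrite /= lebesgue_measure_itv/=; case: ifP => _; rewrite ltry.
- exact: measurable_funTS.
- exists M; split; first exact: num_real.
  by move=> m Mm x _; exact: le_trans (fM x) (ltW Mm).
Qed.

Lemma Int_split a b c f : a <= b -> b <= c ->
  mu.-integrable `[a, c] (EFin \o f) ->
  Int a c f = Int a b f + Int b c f.
Proof.
move=> ab bc intf; apply/eqP; rewrite addrC -subr_eq; apply/eqP.
rewrite !IntE Rintegral_itvB ?bnd_simp// Rintegral_itv_obnd_cbnd//.
by apply: integrableS intf => //; apply: subset_itvr; rewrite bnd_simp.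
Qed.

Lemma Int_quadratic a b c0 c1 c2 : a <= b ->
  Int a b (fun x => c0 + c1 * x + c2 * x ^+ 2) =
  (c0 * b + c1 * (b ^+ 2 / 2) + c2 * (b ^+ 3 / 3)) -
  (c0 * a + c1 * (a ^+ 2 / 2) + c2 * (a ^+ 3 / 3)).
Proof.
rewrite le_eqVlt => /predU1P[<-|ab].
  by rewrite IntE set_itv1 Rintegral_set1 subrr.
pose F := fun x : R => c0 * x + c1 * (x ^+ 2 / 2) + c2 * (x ^+ 3 / 3).
have dF x : is_derive x (1:R) F (c0 + c1 * x + c2 * x ^+ 2).
  by apply: is_derive_eq; rewrite /GRing.scale /=; field.
have cF : continuous F.
  move=> x; apply/differentiable_continuous/derivable1_diffP.
  exact: ex_derive.
rewrite IntE /Rintegral (@continuous_FTC2 _ _ F)//.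
- apply: continuous_subspaceT => x.
  apply: cvgD; [apply: cvgD; [exact: cvg_cst|]|];
    apply: cvgM => //; try exact: cvg_cst.
  exact: exprn_continuous.
- split.
  + by move=> x _; exact: ex_derive.
  + by apply: cvg_at_right_filter; exact: cF.
  + by apply: cvg_at_left_filter; exact: cF.
- by move=> x _; rewrite derive1E; exact: derive_val.
Qed.

(** If the integral vanished, so would [Int a y h] for all [y] near [x], whereas the fundamental
    theorem of calculus gives it the derivative [h x > 0] there. *)
Lemma Int_gt0 a b x h : a < x < b -> mu.-integrable `[a, b] (EFin \o h) ->
  (forall y, a <= y <= b -> 0 <= h y) -> {for x, continuous h} -> 0 < h x ->
  0 < Int a b h.
Proof.
move=> /andP[ax xb] inth h0 ch hx.
have Int0 c d : a <= c -> d <= b -> 0 <= Int c d h.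
  move=> ac db; apply: Rintegral_ge0 => y /=; rewrite in_itv/= => /andP[cy yd].
  by apply: h0; rewrite (le_trans ac)//= (le_trans yd).
rewrite lt_neqAle Int0// andbT; apply/eqP => Ih0.
have [_] := continuous_FTC1_closed xb inth ax ch.
have -> : derive1 (fun y => \int[mu]_(t in `[a, y]) h t) x = 0.
  rewrite derive1E (@near_eq_derive _ _ _ _ (cst 0)) ?derive_cst//.
  near=> y; have ay : a <= y by near: y; exact: lt_le_nbhsr.
  have yb : y <= b by near: y; exact: lt_le_nbhsl.
  apply/eqP; rewrite -IntE eq_le Int0// andbT Ih0 (Int_split _ _ _ _ ay yb)//.
  by rewrite lerDl Int0.
by move=> /esym/eqP; rewrite gt_eqF.
Unshelve. all: by end_near. Qed.

End Int.

(** * A monotone 1-Lipschitz function is the integral of its a.e. derivative *)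

Section Density.
Context {R : realType}.
Notation mu := (@lebesgue_measure R).

Lemma nondecreasing_lipschitz_continuous (F : R -> R) :
  (forall x y, x <= y -> 0 <= F y - F x <= y - x) -> continuous F.
Proof.
move=> FL x; apply/cvgrPdist_le => /= e e0; near=> y.
apply: (@le_trans _ _ `|x - y|); last first.
  by near: y; apply: cvgr_dist_le => //; exact: cvg_id.
have [xy|/ltW yx] := leP x y.
- have /andP[h1 h2] := FL _ _ xy.
  by rewrite distrC (distrC x) (ger0_norm h1) ger0_norm// subr_ge0.
- have /andP[h1 h2] := FL _ _ yx.
  by rewrite (ger0_norm h1) ger0_norm// subr_ge0.
Unshelve. all: by end_near. Qed.

(** Both measures are infima over countable covers by half-open intervals, and each such interval
    has [F]-length at most its length. *)
Lemma lipschitz_stieltjes_le (F : cumulative R R) :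
  (forall x y, x <= y -> F y - F x <= y - x) ->
  forall A, (lebesgue_stieltjes_measure F A <= mu A)%E.
Proof.
move=> FL A; apply: le_ereal_inf_tmp => _ [I [mI AI] <-].
apply: ge_ereal_inf; exists (\sum_(0 <= k <oo) wlength F (I k))%E.
  by exists I.
apply: lee_nneseries => k _; first by rewrite wlength_ge0.
have [[x y] _ /= <-] := mI k.
have [xy|yx] := leP x y; last first.
  by rewrite set_itv_ge ?wlength0// bnd_simp -leNgt ltW.
by rewrite !wlength_itv_bnd// lee_fin FL.
Qed.

Lemma stieltjes_itvoc (F : cumulative R R) (a b : R) : a <= b ->
  lebesgue_stieltjes_measure F `]a, b] = (F b - F a)%:E.
Proof.
move=> ab; rewrite -(@wlength_itv_bnd _ F a b false false)//.
rewrite /lebesgue_stieltjes_measure /measure_extension.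
by rewrite measurable_mu_extE//; exact: is_ocitv.
Qed.

(* F generates a Lebesgue-Stieltjes measure dominated by Lebesgue measure. *)
Lemma lipschitz_radon_nikodym (F : R -> R) :
  (forall x y, x <= y -> 0 <= F y - F x <= y - x) ->
  exists g : R -> R, mu.-integrable setT (EFin \o g) /\
    forall a b, 0 <= a -> a <= b -> b <= 1 ->
      \int[mu]_(x in `]a, b]) g x = F b - F a.
Proof.
move=> FL.
have ndF : {homo F : x y / x <= y}.
  by move=> x y /FL /andP[+ _]; rewrite subr_ge0.
have rcF : right_continuous F.
  by apply: right_continuousW; exact: nondecreasing_lipschitz_continuous.
pose cF : cumulative R R := HB.pack F (isCumulative.Build R _ R F ndF rcF).
pose mF := lebesgue_stieltjes_measure cF.
have m01 : measurable (`]0, 1] : set (measurableTypeR R)) by [].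
have mF01 : (mF `]0%R, 1%R]%classic < +oo)%E.
  by rewrite /mF stieltjes_itvoc// ltry.
(* Restricting to []0, 1]] makes the measure finite, as the Radon-Nikodym theorem requires of
   [nu]. *)
pose nu : {finite_measure set (measurableTypeR R) -> \bar R} :=
  mfrestr m01 mF01.
have nuE A : nu A = mF (A `&` `]0, 1]) by [].
have numu : nu `<< mu.
  apply/null_content_dominatesP => A mA A0.
  apply/eqP; rewrite eq_le measure_ge0 andbT nuE.
  apply: (@le_trans _ _ (mu (A `&` `]0%R, 1%R]))).
    by apply: lipschitz_stieltjes_le => x y /FL/andP[].
  rewrite -A0.
  by apply: le_measure; rewrite ?inE//=; exact: measurableI.
have [g [g0 gfin intg gE]] := radon_nikodym_sigma_finite numu.
have gK : EFin \o (fine \o g) = g by apply/funext => x /=; rewrite fineK.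
exists (fine \o g); split; first by rewrite gK.
move=> a b a0 ab b1; rewrite /Rintegral.
rewrite -[X in integral _ _ X]/(EFin \o (fine \o g)) gK -gE//.
rewrite nuE setIidl; last by apply: subset_itv; rewrite bnd_simp.
by rewrite /mF stieltjes_itvoc.
Qed.

(** All difference quotients lie in [0,1], and so does their limit. *)
Lemma lipschitz_derive1_itv (F : R -> R) x :
  (forall x y, x <= y -> 0 <= F y - F x <= y - x) ->
  derivable F x 1 -> 0 <= derive1 F x <= 1.
Proof.
move=> FL dF.
have slope h : h != 0 -> 0 <= h^-1 * (F (h + x) - F x) <= 1.
  rewrite neq_lt => /orP[h0|h0].
  - have /FL/andP[D0 Dh] : h + x <= x by rewrite gerDr ltW.
    rewrite -[h^-1]opprK -invrN mulNr -mulrN opprB mulrC.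
    rewrite divr_ge0 ?oppr_ge0 ?(ltW h0)//= ler_pdivrMr ?oppr_gt0// mul1r.
    by apply: (le_trans Dh); rewrite opprD addrCA subrr addr0.
  - have /FL/andP[D0 Dh] : x <= h + x by rewrite lerDr ltW.
    rewrite mulrC divr_ge0 ?(ltW h0)//= ler_pdivrMr// mul1r.
    by apply: (le_trans Dh); rewrite addrK.
rewrite derive1E; apply/andP; split.
- apply: limr_ge => //; near=> h.
  have /slope/andP[] : h != 0 by near: h; exact: nbhs_dnbhs_neq.
  by rewrite [h *: _]mulr1.
- apply: limr_le => //; near=> h.
  have /slope/andP[] : h != 0 by near: h; exact: nbhs_dnbhs_neq.
  by rewrite [h *: _]mulr1.
Unshelve. all: by end_near. Qed.

(** The Radon-Nikodym density [g0] is a.e. the derivative of its running integral, hence of [F]. It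
    is then redefined on a null part of [0,1] and outside [0,1], so that the bounds hold
    everywhere. *)
Lemma lipschitz_density (F : R -> R) :
  (forall x y, x <= y -> 0 <= F y - F x <= y - x) ->
  exists (g : R -> R) (N : set R),
    [/\ measurable_fun setT g, forall x, 0 <= g x <= 1,
        measurable N /\ mu N = 0,
        forall a b, 0 <= a -> a <= b -> b <= 1 -> Int a b g = F b - F a &
        forall x, 0 < x < 1 -> ~ N x -> derive1 F x = g x].
Proof.
move=> FL; have [g0 [intg0 g0E]] := lipschitz_radon_nikodym _ FL.
pose G (y : R) := \int[mu]_(t in `](0 : R), y]) g0 t.
have intg0y (y : R) : mu.-integrable `]0, y] (EFin \o g0).
  exact: integrableS intg0.
have [N [mN N0 subN]] :=
  FTC1 intg0y (open_integrable_locally openT intg0).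
have dF x : 0 < x < 1 -> ~ N x -> derivable F x 1 /\ derive1 F x = g0 x.
  move=> /andP[x0 x1] Nx.
  have [dG <-] : derivable G x 1 /\ derive1 G x = g0 x.
    by apply: contrapT => h; apply/Nx/subN => /= /(_ x0).
  (* The density reproduces [F] on [0,1] only, so the two functions agree merely near an interior
     point, which is enough for derivatives. *)
  have FG : \near x, (G + cst (F 0)) x = F x.
    near=> y; rewrite /= /G !fctE g0E ?subrK//.
    - by near: y; exact: lt_le_nbhsr.
    - by near: y; exact: lt_le_nbhsl.
  split.
    apply: (@near_eq_derivable _ _ _ (G + cst (F 0)) F x 1 FG).
    exact: (derivableD dG (derivable_cst _ _ _)).
  rewrite !derive1E -(@near_eq_derive _ _ _ (G + cst (F 0)) F x 1 FG).
  by rewrite (deriveD dG (derivable_cst _ _ _)) derive_cst addr0.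
(* On [D] the density is a derivative of [F], hence in [0,1]; elsewhere it is replaced by 0. *)
pose D := `]0, 1[ `\` N.
have mD : measurable D by exact: measurableD.
have mg0 : measurable_fun setT g0.
  by apply/measurable_EFinP; exact: measurable_int intg0.
have gE x : D x -> (g0 \_ D) x = g0 x by move=> Dx; rewrite patchE mem_set.
have mg : measurable_fun setT (g0 \_ D).
  by apply/(measurable_restrictT _ _).1 => //; exact: measurable_funS mg0.
exists (g0 \_ D), N; split => //.
- move=> x; rewrite patchE; case: ifPn => [|_]; last by rewrite lexx ler01.
  rewrite inE => -[/=]; rewrite in_itv/= => x01 Nx.
  by have [dx <-] := dF _ x01 Nx; exact: lipschitz_derive1_itv.
- move=> a b a0 ab b1; rewrite -g0E// IntE.
  rewrite Rintegral_itv_obnd_cbnd; last exact: integrableS intg0.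
  congr fine; apply: ae_eq_integral => //.
  + exact/measurable_EFinP/measurable_funTS.
  + exact/measurable_EFinP/measurable_funTS.
  + apply: (@negligibleS _ _ _ mu (N `|` ([set 0] `|` [set 1]))); last first.
      apply: negligibleU; first exact/negligibleP.
      by apply: negligibleU; apply/negligibleP => //;
        exact: lebesgue_measure_set1.
    move=> x /= /not_implyP[]; rewrite in_itv/= => /andP[ax xb] gx.
    have [Nx|Nx] := pselect (N x); first by left.
    right; apply: contrapT => /not_orP[x0 x1]; apply: gx.
    congr EFin; apply: gE; split => //=; rewrite in_itv/= !lt_neqAle.
    rewrite (le_trans a0)// (le_trans xb)// !andbT eq_sym.
    by apply/andP; split; exact/eqP.
- move=> x x01 Nx; rewrite gE; last by split.
  by have [] := dF x x01 Nx.
Unshelve. all: by end_near. Qed.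

End Density.

(** * Lengths in the two halves of [0,1], and clamping to [0,1] *)

Section Halves.
Context {R : realType}.
Notation mu := (@lebesgue_measure R).
Implicit Types (u v x y : R).

Definition lo x : R := Num.min x 2^-1.
Definition hi x : R := Num.max 0 (x - 2^-1).

(** Both alternatives include the point 1/2, so later case splits may have to treat that point on
    the wrong side. *)
Lemma lo_hiP x : (x <= 2^-1 /\ lo x = x /\ hi x = 0) \/
                 (2^-1 <= x /\ lo x = 2^-1 /\ hi x = x - 2^-1).
Proof.
rewrite /lo /hi; have [x2|x2] := leP x 2^-1; [left|right].
- by rewrite max_l// subr_le0.
- by rewrite max_r ?subr_ge0 ltW.
Qed.

Lemma lo_lipschitz x y : x <= y -> 0 <= lo y - lo x <= y - x.
Proof.
move=> xy; apply/andP.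
by case: (lo_hiP x) => -[? [-> _]]; case: (lo_hiP y) => -[? [-> _]]; split; lra.
Qed.

Lemma hi_lipschitz x y : x <= y -> 0 <= hi y - hi x <= y - x.
Proof.
move=> xy; apply/andP.
by case: (lo_hiP x) => -[? [_ ->]]; case: (lo_hiP y) => -[? [_ ->]]; split; lra.
Qed.

Lemma continuous_lo : continuous lo.
Proof. exact: (nondecreasing_lipschitz_continuous _ lo_lipschitz). Qed.

Lemma continuous_hi : continuous hi.
Proof. exact: (nondecreasing_lipschitz_continuous _ hi_lipschitz). Qed.

(** A copula is arbitrary outside the unit square. Precomposing with this retraction gives functions
    that are Lipschitz on the whole line. *)
Definition clamp x : R := Num.max 0 (Num.min x 1).

Lemma clampP x : [\/ x <= 0 /\ clamp x = 0, 0 <= x <= 1 /\ clamp x = x |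
                     1 <= x /\ clamp x = 1].
Proof.
rewrite /clamp; have [x1|x1] := leP x 1.
- by have [x0|x0] := leP 0 x; [apply: Or32|apply: Or31; rewrite ltW].
- by apply: Or33; rewrite max_r// ltW.
Qed.

Lemma clamp_itv x : 0 <= clamp x <= 1.
Proof. by case: (clampP x) => -[? ->]; rewrite ?lexx ?ler01. Qed.

Lemma clamp_id x : 0 <= x <= 1 -> clamp x = x.
Proof. by move=> ?; case: (clampP x) => -[? ->]; lra. Qed.

Lemma clamp_lipschitz x y : x <= y -> 0 <= clamp y - clamp x <= y - x.
Proof.
move=> xy; apply/andP.
by case: (clampP x) => -[? ->]; case: (clampP y) => -[? ->]; split; lra.
Qed.

Lemma Int_indic_halves u x y : 0 <= u <= 1 ->
  Int 0 u (fun s => x * \1_(`[0, 2^-1[) s + y * \1_(`[2^-1, 1]) s)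
    = x * lo u + y * hi u.
Proof.
move=> /andP[u0 u1].
have intI (A : set R) : measurable A ->
    mu.-integrable `[0, u] (EFin \o (\1_A : R -> R)).
  move=> mA; apply: (bounded_integrable_itv _ _ 1) => [|t].
    exact: measurable_indic.
  by rewrite indicE; case: (_ \in _); rewrite ?normr1 ?normr0.
have IntI (A : set R) : measurable A ->
    \int[mu]_(x in `[0, u]) (\1_A x : R) = fine (mu (A `&` `[0, u])).
  by move=> mA; rewrite /Rintegral integral_indic.
have intZ c (A : set R) : measurable A ->
    mu.-integrable `[0, u] (EFin \o (fun t => c * \1_A t)).
  by move=> mA; apply: (@integrableZl _ _ _ mu _ _ c _ (intI A mA)).
rewrite IntE RintegralD//; [|exact: intZ..].
rewrite !RintegralZl//; [|exact: intI..].
rewrite !IntI//; congr (_ * _ + _ * _).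
- have [[u2 [-> _]]|[u2 [-> _]]] := lo_hiP u; last first.
    rewrite setIidl; last by apply: subset_itv; rewrite bnd_simp.
    by rewrite lebesgue_measure_itv/= lte_fin invr_gt0 ltr0n oppr0 adde0.
  (* The intersection lies between [[0, u[] and [[0, u]], of equal measure; this covers [u] = 1/2,
     where the half-open interval loses [u]. *)
  have -> : fine (mu (`[0, 2^-1[ `&` `[0, u])) = fine (mu `[0, u[%classic).
    congr fine; apply/eqP; rewrite eq_le; apply/andP; split.
    + rewrite (_ : mu `[0%R, u[%classic = mu `[0%R, u]%classic).
        by apply: le_measure; rewrite ?inE//; exact: measurableI.
      by rewrite !lebesgue_measure_itv.
    + apply: le_measure; rewrite ?inE//; first exact: measurableI.
      move=> t /=; rewrite !in_itv/= => /andP[-> tu] /=.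
      by rewrite (lt_le_trans tu)// ltW.
  rewrite lebesgue_measure_itv/= lte_fin oppr0 adde0.
  by case: ltP => // u0'; apply/eqP; rewrite eq_le u0.
- have [[u2 [_ ->]]|[u2 [_ ->]]] := lo_hiP u.
    (* For [u] at most 1/2 the intersection is contained in the null set {1/2}. *)
    apply/eqP; rewrite eq_le fine_ge0// andbT.
    rewrite -[leRHS]/(fine 0%E) -(lebesgue_measure_set1 (2^-1 : R)).
    rewrite fine_le ?lebesgue_measure_set1//.
      rewrite ge0_fin_numE// (le_lt_trans (measureIl _ _ _))//.
      by rewrite /= lebesgue_measure_itv/=; case: ifP => _; rewrite ltry.
    rewrite -(lebesgue_measure_set1 (2^-1 : R)).
    apply: le_measure; rewrite ?inE//; first exact: measurableI.
    move=> t /=; rewrite !in_itv/= => -[/andP[t1 _] /andP[_ t2]].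
    by apply/eqP; rewrite eq_le t1 (le_trans t2).
  rewrite (_ : _ `&` _ = `[2^-1, u]%classic).
    rewrite lebesgue_measure_itv/= lte_fin; case: ltP => //= u2'.
    by apply/esym/eqP; rewrite subr_eq0 eq_le u2 u2'.
  apply/seteqP; split => t /=; rewrite !in_itv/=.
    by move=> [/andP[-> _] /andP[_ ->]].
  move=> /andP[t2 tu]; rewrite t2 tu (le_trans tu)//=.
  by rewrite (le_trans _ t2)// invr_ge0 ler0n.
Qed.

End Halves.

(** * The copula [Csharp]: closed form, diagonal and energy *)

Section Csharp.
Context {R : realType}.
Notation mu := (@lebesgue_measure R).
Implicit Types (u v x y : R).

Lemma CsharpE u v : 0 <= u <= 1 -> 0 <= v <= 1 ->
  Csharp u v = 2 * (lo u * hi v + hi u * lo v).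
Proof.
move=> u01 v01; rewrite /Csharp.
transitivity (Int 0 u (fun s => (2 * hi v) * \1_(`[0, 2^-1[) s +
                                (2 * lo v) * \1_(`[2^-1, 1]) s)).
  apply: eq_Rintegral => s _.
  transitivity (Int 0 v (fun t => (2 * \1_(`[2^-1, 1]) s) * \1_(`[0, 2^-1[) t +
                                  (2 * \1_(`[0, 2^-1[) s) * \1_(`[2^-1, 1]) t)).
    by apply: eq_Rintegral => t _; rewrite /csharp; ring.
  by rewrite Int_indic_halves//; ring.
by rewrite Int_indic_halves//; ring.
Qed.

Lemma Csharp_copula : is_copula (@Csharp R).
Proof.
have b0 : leb01 (0 : R) by rewrite /leb01; lra.
have b1 : leb01 (1 : R) by rewrite /leb01; lra.
split=> [u u01|u1 u2 v1 v2 u1b u2b v1b v2b u12 v12].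
  rewrite !CsharpE//.
  case: (lo_hiP (0 : R)) => -[? [-> ->]]; case: (lo_hiP (1 : R)) => -[? [-> ->]];
  case: (lo_hiP u) => -[? [-> ->]]; rewrite /leb01 in u01; (repeat split); lra.
rewrite !CsharpE//.
have /andP[+ _] := lo_lipschitz _ _ u12; have /andP[+ _] := hi_lipschitz _ _ u12.
have /andP[+ _] := lo_lipschitz _ _ v12; have /andP[+ _] := hi_lipschitz _ _ v12.
move=> h1 h2 h3 h4.
(* The closed form is a sum of products, so the mass of a rectangle is a sum of products of
   increments of [lo] and [hi]. *)
have -> : 2 * (lo u2 * hi v2 + hi u2 * lo v2) -
    2 * (lo u2 * hi v1 + hi u2 * lo v1) - 2 * (lo u1 * hi v2 + hi u1 * lo v2) +
    2 * (lo u1 * hi v1 + hi u1 * lo v1) =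
    2 * ((lo u2 - lo u1) * (hi v2 - hi v1) + (hi u2 - hi u1) * (lo v2 - lo v1)).
  by ring.
by rewrite mulr_ge0// addr_ge0// mulr_ge0.
Qed.

(** [2 * hi u] is the least diagonal of a copula, and the value 1/4 corresponds to [psi] = 6/4 - 2 =
    -1/2. *)
Lemma Int_2hi : Int 0 1 (fun u => 2 * hi u) = 4^-1 :> R.
Proof.
have h0 : 0 <= 2^-1 :> R by lra.
have h1 : 2^-1 <= 1 :> R by lra.
rewrite (Int_split _ _ _ _ h0 h1); last first.
  apply: continuous_integrable_itv => x.
  by apply: cvgM; [exact: cvg_cst|exact: continuous_hi].
transitivity (Int 0 2^-1 (fun x : R => 0 + 0 * x + 0 * x ^+ 2) +
              Int 2^-1 1 (fun x : R => -1 + 2 * x + 0 * x ^+ 2)).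
  congr (_ + _); apply: eq_Rintegral => x; rewrite inE/= in_itv/= => /andP[? ?];
    by case: (lo_hiP x) => -[? [_ ->]]; lra.
by rewrite !Int_quadratic//; field.
Qed.

(** This is the integral of the squared derivative of [Csharp] in [u]: that derivative is [2 * hi v]
    on the lower half and [2 * lo v] on the upper one, each of length 1/2. *)
Definition sharp_energy v : R := 2 * lo v ^+ 2 + 2 * hi v ^+ 2.

Lemma continuous_sharp_energy : continuous sharp_energy.
Proof.
move=> x; apply: cvgD; (apply: cvgM; first exact: cvg_cst);
  apply: cvgM; by [exact: continuous_lo|exact: continuous_hi].
Qed.

Lemma Int_sharp_energy : Int 0 1 sharp_energy = 5 / 12 :> R.
Proof.
have h0 : 0 <= 2^-1 :> R by lra.
have h1 : 2^-1 <= 1 :> R by lra.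
rewrite (Int_split _ _ _ _ h0 h1); last first.
  by apply: continuous_integrable_itv; exact: continuous_sharp_energy.
transitivity (Int 0 2^-1 (fun x : R => 0 + 0 * x + 2 * x ^+ 2) +
              Int 2^-1 1 (fun x : R => 1 + -2 * x + 2 * x ^+ 2)).
  congr (_ + _); apply: eq_Rintegral => x; rewrite inE/= in_itv/= => /andP[? ?];
    rewrite /sharp_energy;
    case: (lo_hiP x) => -[? [-> ->]]; try by field.
  - have -> : x = 2^-1 by lra.
    by field.
  - have -> : x = 2^-1 by lra.
    by field.
by rewrite !Int_quadratic//; field.
Qed.

(** At interior points [d1] depends only on values inside the unit square, so agreement with
    [Csharp] there suffices. *)
Lemma Int_d1_sqr_sharp (C : R -> R -> R) v :
  (forall u v, leb01 u -> leb01 v -> C u v = Csharp u v) -> 0 <= v <= 1 ->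
  Int 0 1 (fun u => d1 C u v ^+ 2) = sharp_energy v.
Proof.
move=> CE v01.
have d1_near c0 c1 x : (\near x, C x v = c0 + c1 * x) -> d1 C x v = c1.
  move=> near_lin; rewrite /d1 derive1E.
  rewrite (@near_eq_derive _ _ _ _ (fun x : R => c0 + c1 * x) x 1 near_lin).
  have dL : is_derive x (1 : R) (fun x : R => c0 + c1 * x) c1.
    by apply: is_derive_eq; rewrite /GRing.scale /=; ring.
  exact: derive_val.
have d1_lo x : 0 < x < 2^-1 -> d1 C x v = 2 * hi v.
  move=> /andP[x0 x2]; apply: (d1_near 0); near=> y.
  have y0 : 0 <= y by near: y; exact: lt_le_nbhsr.
  have y2 : y <= 2^-1 by near: y; exact: lt_le_nbhsl.
  rewrite CE//; last by apply/andP; split; lra.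
  rewrite CsharpE//; last by apply/andP; split; lra.
  case: (lo_hiP y) => -[? [-> ->]]; first by ring.
  have -> : y = 2^-1 by lra.
  by field.
have d1_hi x : 2^-1 < x < 1 -> d1 C x v = 2 * lo v.
  move=> /andP[x0 x2]; apply: (d1_near (hi v - lo v)); near=> y.
  have y0 : 2^-1 <= y by near: y; exact: lt_le_nbhsr.
  have y2 : y <= 1 by near: y; exact: lt_le_nbhsl.
  rewrite CE//; last by apply/andP; split; lra.
  rewrite CsharpE//; last by apply/andP; split; lra.
  case: (lo_hiP y) => -[? [-> ->]]; last by field.
  have -> : y = 2^-1 by lra.
  by field.
transitivity (Int 0 1 (fun s => (4 * hi v ^+ 2) * \1_(`[0, 2^-1[) s +
                                (4 * lo v ^+ 2) * \1_(`[2^-1, 1]) s)); last first.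
  rewrite Int_indic_halves ?lexx ?ler01// /sharp_energy.
  by case: (lo_hiP (1 : R)) => -[? [-> ->]]; lra.
congr fine; rewrite /lebR.
(* The excluded points are the possible kink at 1/2 and the endpoints, where [d1] also sees values
   outside [0,1]. *)
apply: (@ge0_eq_integral_off_null _ (measurableTypeR R) R mu `[0, 1]
    ([set 0] `|` ([set 2^-1] `|` [set 1]))) => //.
- by do ?apply: measurableU.
- apply/negligibleP; first by do ?apply: measurableU.
  by do ?apply: negligibleU; apply/negligibleP => //;
    exact: lebesgue_measure_set1.
- apply/measurable_EFinP; apply: measurable_funD; apply: measurable_funM => //;
    exact: measurable_indic.
- by move=> x _; rewrite lee_fin sqr_ge0.
- move=> x _; rewrite lee_fin; apply: addr_ge0;
    (apply: mulr_ge0; last by rewrite indicE ler0n);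
    by rewrite mulr_ge0 ?sqr_ge0.
- move=> x /=; rewrite in_itv/= => /andP[x0 x1] /not_orP[nx0 /not_orP[nx2 nx1]].
  congr EFin; have [x2|x2] := ltP x 2^-1.
  + rewrite d1_lo; last by rewrite x2 lt_neqAle x0 !andbT eq_sym; exact/eqP.
    rewrite !indicE mem_set ?memNset/= ?in_itv/= ?x0 ?x2//; last first.
      by rewrite leNgt x2.
    by ring.
  + rewrite d1_hi; last first.
      by rewrite !lt_neqAle x2 x1 !andbT eq_sym; apply/andP; split; exact/eqP.
    rewrite !indicE memNset ?mem_set/= ?in_itv/= ?x1 ?x2//; last first.
      by rewrite ltNge x2 andbF.
    by ring.
Unshelve. all: by end_near. Qed.

End Csharp.

(** The real integral sends an infinite value to 0, so monotonicity needs finiteness; the constant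
    [M] supplies it. *)
Lemma Int_le_bounded {R : realType} (a b M : R) (f g : R -> R) :
  (forall x, a <= x <= b -> 0 <= f x /\ f x <= g x /\ g x <= M) ->
  Int a b f <= Int a b g.
Proof.
move=> fgM; rewrite /Int /lebR /Rintegral; set mu := lebesgue_measure.
have finM : (\int[mu]_(x in `[a, b]) M%:E)%E \is a fin_num.
  rewrite integral_cst//; apply: fin_numM => //.
  by rewrite ge0_fin_numE//= /mu lebesgue_measure_itv/=; case: ifP => _;
    rewrite ltry.
have fin_le (h : R -> R) : (forall x, a <= x <= b -> 0 <= h x <= M) ->
    (\int[mu]_(x in `[a, b]) (h x)%:E)%E \is a fin_num.
  move=> hM; rewrite ge0_fin_numE.
    apply: (@le_lt_trans _ _ (\int[mu]_(x in `[a, b]) M%:E)%E).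
      apply: ge0_le_integral_nonmeasurable => x /=;
        by rewrite in_itv/= => /hM/andP[]; rewrite lee_fin.
    by rewrite ltey_eq finM.
  by apply: integral_ge0 => x /=; rewrite in_itv/= => /hM/andP[]; rewrite lee_fin.
apply: fine_le.
- by apply: fin_le => x /fgM[f0 [fg gM]]; rewrite f0 (le_trans fg).
- by apply: fin_le => x /fgM[f0 [fg gM]]; rewrite gM (le_trans f0).
- by apply: ge0_le_integral_nonmeasurable => x /=; rewrite in_itv/= => /fgM;
    rewrite !lee_fin => -[f0 [fg gM]].
Qed.

(** * Lower bound for the energy of a copula vanishing at (1/2,1/2) *)

Section Energy.
Context {R : realType}.
Notation mu := (@lebesgue_measure R).

(** Integrate [(g x - w) ^+ 2 >= 0] over the interval. *)
Lemma Int_sqr_ge (g : R -> R) a b w : measurable_fun setT g ->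
  (forall x, 0 <= g x <= 1) -> a <= b ->
  2 * w * Int a b g - w ^+ 2 * (b - a) <= Int a b (fun x => g x ^+ 2).
Proof.
move=> mg g01 ab.
have intg : mu.-integrable `[a, b] (EFin \o g).
  apply: (bounded_integrable_itv _ _ 1) => // x.
  by have /andP[? ?] := g01 x; rewrite ger0_norm.
have intg2 : mu.-integrable `[a, b] (EFin \o (fun x => g x ^+ 2)).
  apply: (bounded_integrable_itv _ _ 1) => [|x].
    exact: measurable_funX.
  by have /andP[? ?] := g01 x; rewrite ger0_norm ?sqr_ge0// expr_le1.
have intc c : mu.-integrable `[a, b] (EFin \o cst c).
  by apply: (bounded_integrable_itv _ _ `|c|) => //; exact: measurable_cst.
have intZ : mu.-integrable `[a, b] (EFin \o (fun x => 2 * w * g x)).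
  exact: (@integrableZl _ _ _ mu _ _ (2 * w) _ intg).
have lenab : fine (mu `[a, b]%classic) = b - a.
  rewrite lebesgue_measure_itv/= lte_fin; case: ltP => //= ba.
  by apply/esym/eqP; rewrite subr_eq0 eq_le ab ba.
have -> : 2 * w * Int a b g - w ^+ 2 * (b - a) =
    \int[mu]_(x in `[a, b]) (2 * w * g x - w ^+ 2).
  rewrite (RintegralB _ intZ (intc (w ^+ 2)))// RintegralZl//.
  by rewrite Rintegral_cst//= lenab.
apply: le_Rintegral => //; last first.
  move=> x _; rewrite -subr_ge0.
  have -> : g x ^+ 2 - (2 * w * g x - w ^+ 2) = (g x - w) ^+ 2 by ring.
  exact: sqr_ge0.
exact: (@integrableB _ _ _ mu _ _ (EFin \o (fun x => 2 * w * g x))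
  (EFin \o cst (w ^+ 2))).
Qed.

Variables (C : R -> R -> R) (copC : is_copula C).

(** The two bounds say that the rectangles over [u1,u2] below and above height [v] have nonnegative
    mass. *)
Lemma copula_incr1 u1 u2 v : 0 <= u1 -> u1 <= u2 -> u2 <= 1 -> 0 <= v <= 1 ->
  0 <= C u2 v - C u1 v <= u2 - u1.
Proof.
move=> u10 u12 u21 v01; have [bd incr] := copC.
have l0 : leb01 (0 : R) by rewrite /leb01; lra.
have l1 : leb01 (1 : R) by rewrite /leb01; lra.
have lu1 : leb01 u1 by rewrite /leb01; lra.
have lu2 : leb01 u2 by rewrite /leb01; lra.
have [bu1 [_ [cu1 _]]] := bd _ lu1; have [bu2 [_ [cu2 _]]] := bd _ lu2.
have /andP[v0 v1] := v01.
have := incr _ _ _ _ lu1 lu2 l0 v01 u12 v0.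
have := incr _ _ _ _ lu1 lu2 v01 l1 u12 v1.
rewrite bu1 bu2 cu1 cu2; lra.
Qed.

Lemma copula_incr2 u v1 v2 : 0 <= v1 -> v1 <= v2 -> v2 <= 1 -> 0 <= u <= 1 ->
  0 <= C u v2 - C u v1 <= v2 - v1.
Proof.
move=> v10 v12 v21 u01; have [bd incr] := copC.
have l0 : leb01 (0 : R) by rewrite /leb01; lra.
have l1 : leb01 (1 : R) by rewrite /leb01; lra.
have lv1 : leb01 v1 by rewrite /leb01; lra.
have lv2 : leb01 v2 by rewrite /leb01; lra.
have [_ [bv1 [_ cv1]]] := bd _ lv1; have [_ [bv2 [_ cv2]]] := bd _ lv2.
have /andP[u0 u1] := u01.
have := incr _ _ _ _ l0 u01 lv1 lv2 u0 v12.
have := incr _ _ _ _ u01 l1 lv1 lv2 u1 v12.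
rewrite bv1 bv2 cv1 cv2; lra.
Qed.

(** The clamped section of [C] is monotone and 1-Lipschitz, and near interior points it coincides
    with the section itself, so both have the same derivative there. *)
Lemma copula_density v : 0 <= v <= 1 -> exists g : R -> R,
  [/\ measurable_fun setT g, forall x, 0 <= g x <= 1,
      forall a b, 0 <= a -> a <= b -> b <= 1 -> Int a b g = C b v - C a v &
      Int 0 1 (fun u => d1 C u v ^+ 2) = Int 0 1 (fun u => g u ^+ 2)].
Proof.
move=> v01; pose F x := C (clamp x) v.
have FL x y : x <= y -> 0 <= F y - F x <= y - x.
  move=> /clamp_lipschitz/andP[c0 c1].
  have /andP[x0 x1] := clamp_itv x; have /andP[y0 y1] := clamp_itv y.
  rewrite subr_ge0 in c0.
  by have /andP[-> /le_trans->] := copula_incr1 _ _ _ x0 c0 y1 v01.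
have [g [N [mg g01 [mN N0] gE gd]]] := lipschitz_density _ FL.
exists g; split => //.
  by move=> a b a0 ab b1; rewrite gE// /F !clamp_id//; lra.
congr fine; rewrite /lebR.
apply: (@ge0_eq_integral_off_null _ (measurableTypeR R) R mu `[0, 1]
    (N `|` ([set 0] `|` [set 1]))) => //.
- by do ?apply: measurableU.
- apply/negligibleP; first by do ?apply: measurableU.
  apply: negligibleU; first exact/negligibleP.
  by apply: negligibleU; apply/negligibleP => //; exact: lebesgue_measure_set1.
- apply/measurable_EFinP; apply: measurable_funTS; exact: measurable_funX.
- by move=> x _; rewrite lee_fin sqr_ge0.
- by move=> x _; rewrite lee_fin sqr_ge0.
- move=> x /=; rewrite in_itv/= => /andP[x0 x1] /not_orP[nN /not_orP[n0 n1]].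
  have lt0x : 0 < x by rewrite lt_neqAle x0 andbT eq_sym; exact/eqP.
  have ltx1 : x < 1 by rewrite lt_neqAle x1 andbT; exact/eqP.
  congr ((_ ^+ 2)%:E); rewrite -gd ?lt0x// /d1 !derive1E.
  apply: near_eq_derive; near=> y; rewrite /F clamp_id//.
  apply/andP; split; near: y; [exact: lt_le_nbhsr|exact: lt_le_nbhsl].
Unshelve. all: by end_near. Qed.

Lemma Int_d1_sqr_le1 v : 0 <= v <= 1 -> Int 0 1 (fun u => d1 C u v ^+ 2) <= 1.
Proof.
move=> v01; have [g [mg g01 _ ->]] := copula_density v v01.
apply: (@le_trans _ _ (Int 0 1 (fun x : R => 1 + 0 * x + 0 * x ^+ 2))).
  apply: (Int_le_bounded _ _ 1) => x _; have /andP[? ?] := g01 x.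
  by rewrite sqr_ge0 !mul0r !addr0 expr_le1.
by rewrite Int_quadratic//; lra.
Qed.

Hypothesis C2 : C 2^-1 2^-1 = 0.

(** For [v] below 1/2, monotonicity squeezes the value between [C 2^-1 0] and [C 2^-1 2^-1], both 0.
    Above, the rectangles [1/2,1]x[v,1] and [1/2,1]x[1/2,v] give the two inequalities. *)
Lemma copula_half v : 0 <= v <= 1 -> C 2^-1 v = hi v.
Proof.
move=> v01; have [bd incr] := copC; have /andP[v0 v1] := v01.
have l1 : leb01 (1 : R) by rewrite /leb01; lra.
have l2 : leb01 (2^-1 : R) by rewrite /leb01; lra.
have [C20 [_ [C21 C12]]] := bd _ l2; have [_ [_ [C11 _]]] := bd _ l1.
have [_ [_ [_ C1v]]] := bd _ v01.
have h0 : (0 : R) <= 2^-1 by lra.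
have h1 : (2^-1 : R) <= 1 by lra.
case: (lo_hiP v) => -[v2 [_ ->]].
- have := copula_incr2 _ _ _ v0 v2 h1 l2; have l0 := lexx (0 : R).
  have := copula_incr2 _ _ _ l0 v0 v1 l2; rewrite C2 C20; lra.
- have := incr _ _ _ _ l2 l1 v01 l1 h1 v1.
  have := incr _ _ _ _ l2 l1 l2 v01 h1 v2.
  rewrite C2 C21 C12 C11 C1v; lra.
Qed.

Lemma Int_d1_sqr_ge u v : 0 <= u <= 1 -> 0 <= v <= 1 ->
  sharp_energy v + (C u v - Csharp u v) ^+ 2 <=
  Int 0 1 (fun x => d1 C x v ^+ 2).
Proof.
move=> u01 v01; have [g [mg g01 gE ->]] := copula_density v v01.
have Cv2 := copula_half _ v01.
have [bd _] := copC; have [_ [C0v [_ C1v]]] := bd _ v01.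
have h0 : (0 : R) <= 2^-1 by lra.
have h1 : (2^-1 : R) <= 1 by lra.
have vE : lo v + hi v = v by case: (lo_hiP v) => -[? [-> ->]]; lra.
have intg2 a b : mu.-integrable `[a, b] (EFin \o (fun x => g x ^+ 2)).
  apply: (bounded_integrable_itv _ _ 1) => [|x].
    exact: measurable_funX.
  by have /andP[? ?] := g01 x; rewrite ger0_norm ?sqr_ge0// expr_le1.
have /andP[u0 u1] := u01.
rewrite CsharpE// /sharp_energy.
(* The weights are the values of d1 Csharp on the two halves, except that c is
   added from the left endpoint of the half containing u up to u. *)
case: (lo_hiP u) => -[u2 [-> ->]]; set c := C u v - _.
- rewrite (Int_split _ _ _ _ h0 h1)// (Int_split _ _ _ _ u0 u2)//.
  have CE : C u v = c + 2 * u * hi v by rewrite /c; ring.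
  have := Int_sqr_ge g 0 u (2 * hi v + c) mg g01 u0.
  have := Int_sqr_ge g u 2^-1 (2 * hi v) mg g01 u2.
  have := Int_sqr_ge g 2^-1 1 (2 * lo v) mg g01 h1.
  (* The increment [v - hi v] over the upper half becomes [lo v]. *)
  rewrite !gE// Cv2 C0v C1v CE -[X in X - hi v]vE.
  (* Terms linear in [c] cancel between the two pieces of the lower half. The net gain is
     [2 * c ^+ 2 - c ^+ 2 * u], of which [c ^+ 2] is kept. *)
  have : c ^+ 2 * u <= c ^+ 2 by rewrite ler_piMr// sqr_ge0.
  move: (Int _ _ _) (Int _ _ _) (Int _ _ _) c {CE} => I1 I2 I3 c.
  nra.
- rewrite (Int_split _ _ _ _ h0 h1)// (Int_split _ _ _ _ u2 u1)//.
  have CE : C u v = c + hi v + 2 * (u - 2^-1) * lo v by rewrite /c; field.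
  have := Int_sqr_ge g 0 2^-1 (2 * hi v) mg g01 h0.
  have := Int_sqr_ge g 2^-1 u (2 * lo v + c) mg g01 u2.
  have := Int_sqr_ge g u 1 (2 * lo v) mg g01 u1.
  rewrite !gE// Cv2 C0v C1v CE -[X in X - (c + _ + _)]vE.
  have : c ^+ 2 * (u - 2^-1) <= c ^+ 2.
    by rewrite ler_piMr ?sqr_ge0//; lra.
  move: (Int _ _ _) (Int _ _ _) (Int _ _ _) c {CE} => I1 I2 I3 c.
  nra.
Qed.

End Energy.

(** * Minimal diagonal, the bound on [xi], and uniqueness *)

Section Main.
Context {R : realType}.
Notation mu := (@lebesgue_measure R).

(** This is the lower Fréchet-Hoeffding bound on the diagonal, from the masses of [0,u]x[0,u] and
    [u,1]x[u,1]. *)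
Lemma copula_diag_ge (C : R -> R -> R) u : is_copula C -> 0 <= u <= 1 ->
  2 * hi u <= C u u.
Proof.
move=> [bd incr] u01; have /andP[u0 u1] := u01.
have l0 : leb01 (0 : R) by rewrite /leb01; lra.
have l1 : leb01 (1 : R) by rewrite /leb01; lra.
have [_ [_ [C11 _]]] := bd _ l1; have [Cu0 [C0u [Cu1 C1u]]] := bd _ u01.
have [_ [C00 _]] := bd _ l0.
have := incr _ _ _ _ u01 l1 u01 l1 u1 u1.
have := incr _ _ _ _ l0 u01 l0 u01 u0 u0.
rewrite C11 C1u Cu1 Cu0 C0u C00.
by case: (lo_hiP u) => -[? [_ ->]]; lra.
Qed.

(** The excess of the diagonal over [2 * hi] is continuous and nonnegative. Were it positive at 1/2,
    its integral would be positive and [psi C] would exceed -1/2. *)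
Lemma copula_psi_min (C : R -> R -> R) : is_copula C -> psi C = - 2^-1 ->
  C 2^-1 2^-1 = 0.
Proof.
move=> copC psiC.
have hi2 : hi (2^-1 : R) = 0 by rewrite /hi subrr maxxx.
have half01 : 0 <= (2^-1 : R) <= 1 by lra.
have C2ge0 : 0 <= C 2^-1 2^-1.
  by have := copula_diag_ge C _ copC half01; rewrite hi2 mulr0.
apply/eqP; rewrite eq_le C2ge0 andbT leNgt; apply/negP => C2.
pose D x := C (clamp x) (clamp x).
have cD : continuous D.
  (* The diagonal is only 2-Lipschitz, so the continuity criterion is applied to its half. *)
  have -> : D = (fun x => 2 * (D x / 2)).
    by apply/funext => x; field.
  have cD2 : continuous (fun x => D x / 2).
    apply: nondecreasing_lipschitz_continuous => x y.
    move=> /clamp_lipschitz/andP[c0 c1].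
    have cx := clamp_itv x; have cy := clamp_itv y.
    have /andP[x0 x1] := cx; have /andP[y0 y1] := cy.
    have cxy : clamp x <= clamp y by lra.
    have := copula_incr1 C copC _ _ _ x0 cxy y1 cx.
    have := copula_incr2 C copC _ _ _ x0 cxy y1 cy.
    by rewrite /D; lra.
  by move=> x; apply: cvgM; [exact: cvg_cst|exact: cD2].
pose h x := D x - 2 * hi x.
have c2hi : continuous (fun x : R => 2 * hi x).
  by move=> x; apply: cvgM; [exact: cvg_cst|exact: continuous_hi].
have ch : continuous h by move=> x; apply: cvgB; [exact: cD|exact: c2hi].
have : 0 < Int 0 1 h.
  apply: (@Int_gt0 _ _ _ 2^-1).
  - by lra.
  - exact: continuous_integrable_itv.
  - by move=> x x01; rewrite /h /D clamp_id// subr_ge0 copula_diag_ge.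
  - exact: ch.
  - by rewrite /h /D clamp_id// hi2 mulr0 subr0.
rewrite IntE RintegralB//; try exact: continuous_integrable_itv.
rewrite -!IntE Int_2hi.
have -> : Int 0 1 D = Int 0 1 (fun u => C u u).
  apply: eq_Rintegral => x; rewrite inE/= in_itv/= => x01.
  by rewrite /D clamp_id.
by move: psiC; rewrite /psi; lra.
Qed.

(** Allowing any [C] that agrees with [Csharp] on the square serves both the value of [xi] at
    [Csharp] and the converse in the equality case. *)
Lemma xi_sharp (C : R -> R -> R) :
  (forall u v, leb01 u -> leb01 v -> C u v = Csharp u v) -> xi C = 2^-1.
Proof.
move=> CE; rewrite /xi.
have -> : Int 0 1 (fun v => Int 0 1 (fun u => d1 C u v ^+ 2)) = 5 / 12.
  rewrite -Int_sharp_energy; apply: eq_Rintegral => v.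
  by rewrite inE/= in_itv/= => v01; exact: Int_d1_sqr_sharp.
by lra.
Qed.

Lemma psi_Csharp : psi (@Csharp R) = - 2^-1.
Proof.
rewrite /psi.
have -> : Int 0 1 (fun u : R => Csharp u u) = 4^-1.
  rewrite -Int_2hi; apply: eq_Rintegral => u; rewrite inE/= in_itv/= => u01.
  by rewrite CsharpE//; case: (lo_hiP u) => -[? [-> ->]]; field.
by lra.
Qed.

Variables (C : R -> R -> R) (copC : is_copula C) (C2 : C 2^-1 2^-1 = 0).

Lemma xi_ge (f : R -> R) :
  (forall v, 0 <= v <= 1 ->
    0 <= f v /\ f v <= Int 0 1 (fun u => d1 C u v ^+ 2)) ->
  6 * Int 0 1 f - 2 <= xi C.
Proof.
move=> fE; rewrite /xi lerD2r ler_pM2l//; apply: (Int_le_bounded _ _ 1) => v v01.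
by have [f0 fv] := fE v v01; split=> //; split=> //; exact: Int_d1_sqr_le1.
Qed.

Lemma sharp_energy_ge0 (v : R) : 0 <= sharp_energy v.
Proof. by rewrite addr_ge0// mulr_ge0// sqr_ge0. Qed.

Lemma xi_min : 2^-1 <= xi C.
Proof.
have := xi_ge sharp_energy; rewrite Int_sharp_energy.
have -> : 6 * (5 / 12) - 2 = 2^-1 :> R by lra.
apply=> v v01; split; first exact: sharp_energy_ge0.
(* Any first coordinate in [0,1] would do, since the square is dropped. *)
apply: le_trans (Int_d1_sqr_ge C copC C2 v v v01 v01).
by rewrite lerDl sqr_ge0.
Qed.

(** For fixed [u] the squared defect is continuous in the second variable. Were it nonzero at an
    interior [v], its integral would push [xi C] above 1/2. *)
Lemma xi_min_unique u v : xi C = 2^-1 -> 0 <= u <= 1 -> 0 <= v <= 1 ->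
  C u v = Csharp u v.
Proof.
move=> xiC u01 v01; have [bd _] := copC; have [bds _] := @Csharp_copula R.
(* At the endpoints the boundary values of copulas decide; [Int_gt0] requires an interior point. *)
have [->|v0] := eqVneq v 0.
  by have [-> _] := bd _ u01; have [-> _] := bds _ u01.
have [->|v1] := eqVneq v 1.
  by have [_ [_ [-> _]]] := bd _ u01; have [_ [_ [-> _]]] := bds _ u01.
have {v0 v1} v01' : 0 < v < 1.
  by move: v01; rewrite !lt_neqAle eq_sym v0 v1.
apply/eqP/negPn/negP => neq.
(* Clamping [C] and using the closed form of [Csharp] makes [h] continuous on the whole line. *)
pose h y := (C u (clamp y) - 2 * (lo u * hi y + hi u * lo y)) ^+ 2.
have hE y : 0 <= y <= 1 -> h y = (C u y - Csharp u y) ^+ 2.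
  by move=> y01; rewrite /h clamp_id// CsharpE.
have cC : continuous (fun y => C u (clamp y)).
  apply: nondecreasing_lipschitz_continuous => x y.
  move=> /clamp_lipschitz/andP[c0 c1].
  have /andP[x0 x1] := clamp_itv x; have /andP[y0 y1] := clamp_itv y.
  have cxy : clamp x <= clamp y by lra.
  by have := copula_incr2 C copC _ _ _ x0 cxy y1 u01; lra.
have cS : continuous (fun y => 2 * (lo u * hi y + hi u * lo y)).
  move=> x; apply: cvgM; first exact: cvg_cst.
  by apply: cvgD; apply: cvgM; [exact: cvg_cst|exact: continuous_hi|
                               exact: cvg_cst|exact: continuous_lo].
have ch : continuous h.
  have cB : continuous (fun y => C u (clamp y) - 2 * (lo u * hi y + hi u * lo y)).
    by move=> x; apply: cvgB; [exact: cC|exact: cS].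
  by move=> x; apply: cvgM; exact: cB.
have Ih : 0 < Int 0 1 h.
  apply: (@Int_gt0 _ _ _ v) => //.
  - exact: continuous_integrable_itv.
  - by move=> y _; exact: sqr_ge0.
  - exact: ch.
  - by rewrite hE// lt_neqAle sqr_ge0 andbT eq_sym sqrf_eq0 subr_eq0.
have := xi_ge (fun y => sharp_energy y + h y).
rewrite xiC IntE RintegralD//; try apply: continuous_integrable_itv => //.
  rewrite -!IntE Int_sharp_energy => H.
  suff : 6 * (5 / 12 + Int 0 1 h) - 2 <= 2^-1 by lra.
  apply: H => y y01; rewrite hE//; split.
    by rewrite addr_ge0 ?sqr_ge0// sharp_energy_ge0.
  exact: Int_d1_sqr_ge.
exact: continuous_sharp_energy.
Qed.

End Main.

Theorem mainTheorem8 (R : realType) :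
  is_copula (@Csharp R) /\
  psi (@Csharp R) = - 2^-1 /\
  xi (@Csharp R) = 2^-1 /\
  (forall C : R -> R -> R, is_copula C -> psi C = - 2^-1 ->
     2^-1 <= xi C /\
     (xi C = 2^-1 <-> (forall u v, leb01 u -> leb01 v -> C u v = Csharp u v))).
Proof.
split; first exact: Csharp_copula.
split; first exact: psi_Csharp.
split; first exact: xi_sharp.
move=> C copC psiC; have C2 := copula_psi_min C copC psiC.
split; first exact: xi_min.
split; last exact: xi_sharp.
by move=> xiC u v; exact: xi_min_unique.
Qed.
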